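(* Let $\pi,\widehat\pi$ be probability distributions both supported on $[-h,h]$. Suppose that there exist $a,b\in[-h,h]$ with $a<b$, and $\epsilon\in(0,\frac12)$, such that $\widehat\pi([-h,a])>\pi([-h,b])+\epsilon$. Then there exists a polynomial $p$ of degree $O_h\left(\frac1{b-a}\log\frac1\epsilon\right)$ such that $0\le p(x)\le1$ for all $x\in[-h,h]$, and $$\left|\mathbb{E}_{\widehat\pi}[p(\theta)]-\mathbb{E}_\pi[p(\theta)]\right|\ge\frac\epsilon2.$$
   Context: $h>0$. $O_h(\cdot)$ means bounded by a constant depending only on $h$ times the argument. $\mathbb{E}_\mu[p(\theta)]=\int p\,d\mu$. *)

(* Defs.v *)
From HB Require Import structures.
From mathcomp Require Export all_boot all_order all_algebra.
From mathcomp Require Export all_classical all_reals all_analysis.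

Set Implicit Arguments.
Unset Strict Implicit.
Unset Printing Implicit Defensive.

Import Order.TTheory GRing.Theory Num.Theory.
Import numFieldNormedType.Exports.

Local Open Scope classical_set_scope.
Local Open Scope ring_scope.

(* A Borel probability measure on R is supported on the (closed) set S when it
   gives S full mass; for closed S this says that S contains the topological
   support. *)
Definition supported_on (R : realType) (mu : probability (measurableTypeR R) R)
  (S : set R) : Prop := mu S = 1%E.

(* The zero polynomial, of size 0, gets degree 0. *)
Definition degree (R : realType) (p : {poly R}) : nat := (size p).-1.

(* Main.v *)
Require Import Defs.
From HB Require Import structures.
From mathcomp Require Import all_boot all_order all_algebra.
From mathcomp Require Import all_classical all_reals all_analysis.
From mathcomp Require Import measurable_realfun polyrcf ring lra.

(** A distribution function can be tested against polynomials because a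
polynomial of moderate degree can imitate a step.  If [p] is within [eps / 4]
of 1 on [[- h, a]], within [eps / 4] of 0 on [[b, h]], and between 0 and 1
everywhere on [[- h, h]], then [E_pihat p >= (1 - eps / 4) pihat [- h, a]]
and [E_pi p <= pi [- h, b] + eps / 4]; the assumed gap [eps] between the two
masses shrinks by at most [eps / 2].

The point is to build [p] with degree [O(log (1 / eps) / (b - a))].  After an
affine change of variable the step is at 0, on [[- 1, 1]], with a transition
zone of half-width [d = (b - a) / (4 h)].  The step is the normalized
antiderivative of a positive kernel [K] peaked at 0.  The kernel is a power
[(D / n) ^ (2 r)] of the Dirichlet kernel [D (sin t) = sin (n t) / sin t],
[n] odd, which is a polynomial of degree [n - 1] in [sin t]
([dirichlet_poly]).  Two elementary bounds suffice:
- [|D x| <= 1 / |x|] ([dirichlet_tail]), so that [K x <= (n x) ^ (- 2 r)];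
- [D x >= 5 / 6 n] when [n |x| <= 1] ([dirichlet_center]), so that
  [K >= (25 / 36) ^ r] on an interval of length [2 / n].
With [n d >= 2], comparing [K] with a multiple of [1 / x ^ 2] beyond [d]
bounds each tail by [2 * 4 ^ (- r) / n], and the tail is at most
[(9 / 25) ^ r] times the total mass ([step_poly]).  Both masses scale as
[1 / n], so no factor [log n] enters: [r] of order [log (1 / eps)] and [n] of
order [h / (b - a)] are enough, and the degree is of order [n r]. *)

Set Implicit Arguments.
Unset Strict Implicit.
Unset Printing Implicit Defensive.

Import Order.TTheory GRing.Theory Num.Theory.
Import numFieldNormedType.Exports.

Local Open Scope classical_set_scope.
Local Open Scope ring_scope.

(** * The Dirichlet kernel as a polynomial in the sine *)

(** The Chebyshev polynomial [T_k] composed with [1 - 2 X ^ 2]: since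
[cos (2 t) = 1 - 2 (sin t) ^ 2], its value at [sin t] is [cos (2 k t)]. *)
Fixpoint cheb (R : realType) (k : nat) : {poly R} :=
  match k with
  | 0 => 1
  | 1 => 1 - 2 *: 'X^2
  | (k'.+1 as k1).+1 => 2 *: (1 - 2 *: 'X^2) * cheb R k1 - cheb R k'
  end.

Lemma chebS (R : realType) k :
  cheb R k.+2 = 2 *: (1 - 2 *: 'X^2) * cheb R k.+1 - cheb R k.
Proof. by []. Qed.

Lemma cos_double (R : realType) (t : R) : cos (2 * t) = 1 - 2 * sin t ^+ 2.
Proof. rewrite mulr_natl cos_mulr2n cos2sin2; ring. Qed.

Lemma cheb_sin (R : realType) (k : nat) (t : R) :
  (cheb R k).[sin t] = cos (2 * (k%:R * t)).
Proof.
have c1 : (1 - 2 *: 'X^2 : {poly R}).[sin t] = cos (2 * t).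
  by rewrite cos_double !(hornerD, hornerN, hornerC, hornerZ, hornerXn).
elim/ltn_ind: k => -[|[|k]] IH.
- by rewrite hornerC mul0r mulr0 cos0.
- by rewrite mul1r c1.
rewrite chebS hornerD hornerN hornerM hornerZ c1 !IH//.
have -> : 2 * (k.+2%:R * t) = 2 * (k.+1%:R * t) + 2 * t by ring.
have -> : 2 * (k%:R * t) = 2 * (k.+1%:R * t) - 2 * t by ring.
rewrite cosB cosD; ring.
Qed.

Lemma size_cheb (R : realType) (k : nat) : (size (cheb R k) <= k.*2.+1)%N.
Proof.
have s2 : (size (1 - 2 *: 'X^2 : {poly R})%R <= 3)%N.
  rewrite (leq_trans (size_polyD _ _))// size_poly1 size_polyN geq_max/=.
  by rewrite (leq_trans (size_scale_leq _ _))// size_polyXn.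
elim/ltn_ind: k => -[|[|k]] IH; rewrite ?size_poly1//.
rewrite chebS (leq_trans (size_polyD _ _))// size_polyN geq_max.
rewrite (leq_trans (IH k _))//; last by rewrite ltnS leq_double leqW.
rewrite andbT -scalerAl (leq_trans (size_scale_leq _ _))//.
rewrite (leq_trans (size_polyMleq _ _))//.
have := leq_add s2 (IH k.+1 (ltnSn _)); rewrite !doubleS !addSn !add0n.
by case: (_ + _)%N.
Qed.

Lemma ler_norm_sinM (R : realType) (k : nat) (t : R) :
  `|sin (k%:R * t)| <= k%:R * `|sin t|.
Proof.
elim: k => [|k IH]; first by rewrite !mul0r sin0 normr0.
have cos_norm (u : R) : `|cos u| <= 1 by rewrite ler_norml cos_geN1 cos_le1.
rewrite -natr1 !mulrDl !mul1r sinD (le_trans (ler_normD _ _))// !normrM.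
by apply: lerD; rewrite ?ler_piMl// (le_trans _ IH)// ler_piMr.
Qed.

(** The classical expansion [sin ((2 m + 1) t) / sin t =
1 + 2 (cos (2 t) + ... + cos (2 m t))]. *)
Definition dirichlet_poly (R : realType) (m : nat) : {poly R} :=
  1 + \sum_(k < m) 2 *: cheb R k.+1.

Lemma dirichletS (R : realType) m :
  dirichlet_poly R m.+1 = dirichlet_poly R m + 2 *: cheb R m.+1.
Proof. by rewrite /dirichlet_poly big_ord_recr addrA. Qed.

Lemma size_dirichlet (R : realType) m :
  (size (dirichlet_poly R m) <= m.*2.+1)%N.
Proof.
elim: m => [|m IH]; first by rewrite /dirichlet_poly big_ord0 addr0 size_poly1.
rewrite dirichletS (leq_trans (size_polyD _ _))// geq_max.
rewrite (leq_trans IH) ?ltnS ?leq_double//=.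
by apply: leq_trans (size_scale_leq _ _) _; exact: size_cheb.
Qed.

(** The sum telescopes, because
[2 cos (2 k t) sin t = sin ((2 k + 1) t) - sin ((2 k - 1) t)]. *)
Lemma dirichlet_sin (R : realType) m (t : R) :
  (dirichlet_poly R m).[sin t] * sin t = sin (m.*2.+1%:R * t).
Proof.
elim: m => [|m IH];
  first by rewrite /dirichlet_poly big_ord0 addr0 hornerC !mul1r.
rewrite dirichletS hornerD hornerZ mulrDl IH cheb_sin.
rewrite -!muln2.
have -> : (m * 2).+1%:R * t = 2 * (m.+1%:R * t) - t by ring.
have -> : (m.+1 * 2).+1%:R * t = 2 * (m.+1%:R * t) + t by ring.
rewrite sinB sinD; ring.
Qed.

(** Each cosine is [1 - 2 (sin (k t)) ^ 2 >= 1 - 2 k ^ 2 (sin t) ^ 2]; the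
sum of the squares up to [m] is [m (m + 1) (2 m + 1) / 6]. *)
Lemma dirichlet_sin_ge (R : realType) m (t : R) :
  m.*2.+1%:R * (1 - 2 / 3 * (m%:R * m.+1%:R) * sin t ^+ 2)
    <= (dirichlet_poly R m).[sin t].
Proof.
elim: m => [|m IH];
  first by rewrite /dirichlet_poly big_ord0 addr0 hornerC !(mul0r, mulr0) subr0
    mulr1.
rewrite dirichletS hornerD hornerZ cheb_sin cos_double.
have := ler_norm_sinM m.+1 t; rewrite -ler_sqr ?nnegrE ?mulr_ge0//.
rewrite exprMn !real_normK ?num_real// => H.
move: IH; rewrite -!muln2 => IH.
have {}H : 2 * (1 - 2 * (m.+1%:R ^+ 2 * sin t ^+ 2)) <=
    2 * (1 - 2 * sin (m.+1%:R * t) ^+ 2) by lra.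
apply: le_trans (lerD IH H).
by rewrite le_eqVlt; apply/orP; left; apply/eqP; field.
Qed.

Lemma dirichlet_tail (R : realType) m (x : R) : -1 <= x <= 1 ->
  ((dirichlet_poly R m).[x] * x) ^+ 2 <= 1.
Proof.
move=> xI; rewrite -(@asinK R x) ?in_itv//= dirichlet_sin sin2cos2.
by rewrite gerBl sqr_ge0.
Qed.

(** With [n = 2 m + 1], the relative loss in [dirichlet_sin_ge] is
[2 / 3 * m (m + 1) x ^ 2 <= (n x) ^ 2 / 6 <= 1 / 6]. *)
Lemma dirichlet_center (R : realType) m (x : R) : -1 <= x <= 1 ->
  (m.*2.+1%:R * x) ^+ 2 <= 1 -> 5 / 6 * m.*2.+1%:R <= (dirichlet_poly R m).[x].
Proof.
move=> xI; rewrite -(@asinK R x) ?in_itv//= => H.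
apply: le_trans (dirichlet_sin_ge m _).
rewrite mulrC ler_pM2l ?ltr0n//; move: H; rewrite -muln2.
set s := sin _.
rewrite (_ : (m * 2).+1%:R = 2 * m%:R + 1 :> R); last by ring.
rewrite -natr1; have := sqr_ge0 s; nra.
Qed.

(** * A polynomial step *)

Lemma poly_primitive (R : numFieldType) (p : {poly R}) :
  exists2 q : {poly R}, q^`() = p & (size q <= (size p).+1)%N.
Proof.
exists (\poly_(i < (size p).+1) (p`_i.-1 / i%:R)); last exact: size_poly.
apply/polyP => i; rewrite coef_deriv coef_poly ltnS.
case: ltnP => [_|/(nth_default 0)->]; last by rewrite mul0rn.
by rewrite -[LHS]mulr_natr divfK ?pnatr_eq0.
Qed.

(** The antiderivative of [A / x ^ 2] is [- A / x]: the function
[F x + A / x] is nonincreasing on [[d, 1]]. *)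
Lemma inv_sqr_tail (R : realType) (F : {poly R}) (A d : R) : 0 < d -> d <= 1 ->
  0 <= A -> (forall x, d <= x <= 1 -> F^`().[x] <= A / x ^+ 2) ->
  F.[1] - F.[d] <= A / d.
Proof.
move=> d0 d1 A0 dF; pose f x := F.[x] + A * x^-1.
have df x : d <= x -> is_derive x 1 f (F^`().[x] - A / x ^+ 2).
  move=> dx; have x0 : x != 0 by rewrite gt_eqF// (lt_le_trans d0).
  have := @is_deriveV R id x 1 1 x0 (is_derive_id _ _) => dV.
  apply: trigger_derive.
  by rewrite scaler1 scalerN.
suff : f 1 <= f d by rewrite /f invr1 mulr1; move: A0; lra.
apply: (@ler0_derive1_le_cc R f d 1); rewrite ?in_itv/= ?lexx ?d1//.
- by move=> x; rewrite in_itv/= => /andP[/ltW dx _]; case: (df x dx).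
- move=> x; rewrite in_itv/= => /andP[/ltW dx /ltW x1].
  by rewrite derive1E; case: (df x dx) => _ ->; rewrite subr_le0 dF// dx x1.
- apply: derivable_within_continuous => x; rewrite in_itv/= => /andP[dx _].
  by case: (df x dx).
Qed.

(** The kernel is an even power, hence nonnegative.  Far from 0, one factor
[(D / n) ^ 2] is bounded by [1 / (n x) ^ 2], whose integral beyond [d] is of
order [1 / n], and the other [s] factors are bounded by
[1 / (n d) ^ 2 <= 1 / 4]. *)
Lemma kernel_poly (R : realType) (m s : nat) (d : R) :
  0 < d -> 2 <= m.*2.+1%:R * d ->
  exists K : {poly R},
    [/\ (size K <= (4 * m * s.+1).+1)%N,
        forall x, 0 <= K.[x],
        forall x, d <= `|x| <= 1 ->
          K.[x] <= (4^-1) ^+ s / m.*2.+1%:R ^+ 2 / x ^+ 2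
      & forall x, m.*2.+1%:R * `|x| <= 1 -> (25 / 36) ^+ s.+1 <= K.[x]].
Proof.
set n : R := m.*2.+1%:R => d0 nd.
have n1 : 1 <= n by rewrite ler1n.
have n0 : 0 < n by lra.
exists ((n^-1 *: dirichlet_poly R m) ^+ 2 ^+ s.+1).
have KE x : ((n^-1 *: dirichlet_poly R m) ^+ 2 ^+ s.+1).[x]
    = ((n^-1 * (dirichlet_poly R m).[x]) ^+ 2) ^+ s.+1.
  by rewrite 2!horner_exp hornerZ.
split => [|x|x|x]; rewrite ?KE.
- rewrite -exprM (leq_trans (size_poly_exp_leq _ _))// ltnS.
  have : ((size (n^-1 *: dirichlet_poly R m)).-1 <= m.*2)%N.
    have := leq_trans (size_scale_leq n^-1 _) (size_dirichlet R m).
    by case: (size _).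
  move=> sD; rewrite (_ : 4 * m * s.+1 = m.*2 * (2 * s.+1))%N.
    by rewrite leq_mul2r sD orbT.
  by rewrite -muln2; ring.
- by rewrite exprn_ge0 ?sqr_ge0.
- move=> /andP[dx x1]; have x2 : d ^+ 2 <= x ^+ 2.
    by rewrite -(real_normK (num_real x)) ler_sqr ?nnegrE// ltW.
  have x20 : 0 < x ^+ 2 by rewrite (lt_le_trans _ x2)// exprn_gt0.
  have K1 : (n^-1 * (dirichlet_poly R m).[x]) ^+ 2 <= n ^- 2 / x ^+ 2.
    rewrite exprMn exprVn ler_pM2l ?invr_gt0 ?exprn_gt0//.
    rewrite -[X in _ <= X]mul1r ler_pdivlMr// -exprMn dirichlet_tail//.
    by rewrite -ler_norml.
  have K2 : n ^- 2 / x ^+ 2 <= 4^-1.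
    have n20 : 0 < n ^+ 2 by rewrite exprn_gt0.
    have nx0 : 0 < n ^+ 2 * x ^+ 2 by rewrite mulr_gt0.
    rewrite -invfM lef_pV2 ?posrE//.
    apply: (@le_trans _ _ ((n * d) ^+ 2)); first nra.
    by rewrite exprMn ler_pM2l ?exprn_gt0.
  rewrite exprSr -mulrA; apply: ler_pM => //; rewrite ?sqr_ge0//.
    by rewrite exprn_ge0// sqr_ge0.
  by apply: lerXn2r; rewrite ?nnegrE ?sqr_ge0// (le_trans K1).
- move=> nx; apply: lerXn2r; rewrite ?nnegrE ?sqr_ge0//.
  have D : 5 / 6 * n <= (dirichlet_poly R m).[x].
    apply: dirichlet_center.
      rewrite -ler_norml (le_trans _ nx)// ler_peMl//.
    rewrite -real_normK ?num_real// normrM (ger0_norm (ltW n0)).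
    by rewrite exprn_ile1 ?mulr_ge0 ?(ltW n0).
  have : 5 / 6 <= n^-1 * (dirichlet_poly R m).[x].
    by rewrite ler_pdivlMl// mulrC.
  by set y := n^-1 * _; nra.
Qed.

(** The step is [(F 1 - F) / (F 1 - F (- 1))] with [F] an antiderivative of
the kernel; its defect on either side is a tail of the kernel divided by the
total mass, hence at most
[(4 ^ (- s) / (n ^ 2 d)) / (2 / n * (25 / 36) ^ (s + 1))]. *)
Lemma step_poly (R : realType) (m s : nat) (d : R) :
  0 < d -> d <= 1 -> 2 <= m.*2.+1%:R * d ->
  exists q : {poly R},
    [/\ (size q <= (4 * m * s.+1).+2)%N,
        forall x, -1 <= x <= 1 -> 0 <= q.[x] <= 1,
        forall x, d <= x <= 1 -> q.[x] <= (9 / 25) ^+ s.+1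
      & forall x, -1 <= x <= - d -> 1 - (9 / 25) ^+ s.+1 <= q.[x]].
Proof.
move=> d0 d1 nd.
have [K [sK K0 Ktail Kcenter]] := kernel_poly s d0 nd.
set n : R := m.*2.+1%:R in nd Ktail Kcenter.
have n1 : 1 <= n by rewrite ler1n.
clearbody n.
have n0 : 0 < n by lra.
have [F dF sF] := poly_primitive K.
have Fle x y : x <= y -> F.[x] <= F.[y].
  move=> xy; apply: (@ler_hornerW _ x y); rewrite ?in_itv/= ?lexx ?xy//.
  by move=> z _; rewrite dF.
set A := (4^-1) ^+ s / n ^+ 2 in Ktail.
have A0 : 0 <= A by rewrite divr_ge0 ?exprn_ge0// ltW.
have tailR : F.[1] - F.[d] <= A / d.
  apply: inv_sqr_tail => // x /andP[dx x1]; rewrite dF Ktail//.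
  by rewrite ger0_norm ?dx// (le_trans _ dx)// ltW.
(* The left tail is the right tail of the antiderivative reflected at 0. *)
have tailL : F.[-d] - F.[-1] <= A / d.
  have := @inv_sqr_tail R (- (F \Po - 'X)) A d d0 d1 A0.
  rewrite !hornerN !horner_comp !hornerN !hornerX opprK addrC; apply.
  move=> x /andP[dx x1]; rewrite derivN deriv_comp derivN derivX mulrN1 opprK.
  rewrite horner_comp hornerN hornerX dF -[x ^+ 2]sqrrN Ktail// normrN.
  by rewrite ger0_norm ?dx// (le_trans _ dx)// ltW.
have nI : n^-1 <= 1 by rewrite invf_le1.
have nI0 : 0 < n^-1 by rewrite invr_gt0.
have center : 2 / n * (25 / 36) ^+ s.+1 <= F.[1] - F.[-1].
  (* On [[- 1 / n, 1 / n]], [F] has slope at least [(25 / 36) ^ (s + 1)]. *)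
  have H : (F - (25 / 36) ^+ s.+1 *: 'X).[- n^-1]
      <= (F - (25 / 36) ^+ s.+1 *: 'X).[n^-1].
    apply: (@ler_hornerW _ (- n^-1) n^-1);
      rewrite ?in_itv/= ?lexx ?andbT/=; try lra.
    move=> x; rewrite in_itv/= -ltr_norml => /ltW xn.
    rewrite derivB derivZ derivX alg_polyC hornerD hornerN hornerC dF.
    by rewrite subr_ge0 Kcenter// mulrC -ler_pdivlMr// div1r.
  have := Fle _ _ nI; have : F.[-1] <= F.[- n^-1] by apply: Fle; lra.
  move: H; rewrite !(hornerD, hornerN, hornerZ, hornerX).
  set c := _ ^+ _; lra.
set M := F.[1] - F.[-1] in center.
have c0 : 0 < (25 / 36 : R) ^+ s.+1 by rewrite exprn_gt0//; lra.
have M0 : 0 < M by apply: lt_le_trans center; rewrite !mulr_gt0.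
have tail_center : A / d <= (9 / 25) ^+ s.+1 * M.
  apply: (@le_trans _ _ ((9 / 25) ^+ s.+1 * (2 / n * (25 / 36) ^+ s.+1)));
    last by rewrite ler_wpM2l ?exprn_ge0//; lra.
  (* Since 9 / 25 * 25 / 36 = 1 / 4, only a factor n d / 2 >= 1 remains. *)
  rewrite mulrCA -exprMn (_ : 9 / 25 * (25 / 36) = 4^-1); last by field.
  rewrite exprSr ler_pdivrMr// /A.
  rewrite (_ : _ * d = 4^-1 ^+ s / n ^+ 2 * (n * d / 2)).
    by rewrite ler_peMr// ler_pdivlMr// mul1r.
  by field; lra.
exists (M^-1 *: (F.[1]%:P - F)); have qE x :
    (M^-1 *: (F.[1]%:P - F)).[x] = (F.[1] - F.[x]) / M.
  by rewrite hornerZ hornerD hornerN hornerC mulrC.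
split => [|x /andP[x1 x2]|x /andP[x1 x2]|x /andP[x1 x2]]; rewrite ?qE.
- rewrite (leq_trans (size_scale_leq _ _))// (leq_trans (size_polyD _ _))//.
  rewrite size_polyN geq_max (leq_trans (size_polyC_leq1 _))//.
  by rewrite (leq_trans sF).
- rewrite divr_ge0 ?subr_ge0 ?Fle ?(ltW M0)//= ler_pdivrMr// mul1r /M.
  by have := Fle _ _ x1; lra.
- rewrite ler_pdivrMr// (le_trans _ tail_center)// (le_trans _ tailR)//.
  by have := Fle _ _ x1; lra.
- rewrite ler_pdivlMr// mulrBl mul1r; have := Fle _ _ x2.
  by move: tail_center tailL; rewrite /M; lra.
Qed.

(** * Expectations of functions controlled on a set of full measure *)

(** The function may be unbounded outside [D], as polynomials are in general, but
it agrees almost everywhere with its restriction to [D], extended by 0. *)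
Lemma expectation_restrict d (T : measurableType d) (R : realType)
    (P : probability T R) (D : set T) (f : T -> R) :
  measurable D -> P D = 1%E -> measurable_fun setT f ->
  ('E_P[f] = \int[P]_(x in D) (f x)%:E)%E.
Proof.
move=> mD PD mf; rewrite unlock [RHS]integral_mkcond.
have mEf : measurable_fun setT (EFin \o f) by apply/measurable_EFinP.
apply: ae_eq_integral => //; first by apply/(measurable_restrictT _ mD);
  exact: measurable_funTS.
exists (~` D); split; first exact: measurableC.
  by apply: etrans (probability_setC P mD) _; rewrite PD subee.
move=> x /= /not_implyP[_ fx] Dx; apply: fx.
by rewrite patchE mem_set.
Qed.

Lemma expectation_ge d (T : measurableType d) (R : realType)
    (P : probability T R) (D A : set T) (f : T -> R) (c : R) :
  measurable D -> P D = 1%E -> measurable_fun setT f ->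
  (forall x, D x -> 0 <= f x) ->
  measurable A -> A `<=` D -> 0 <= c -> (forall x, A x -> c <= f x) ->
  (c%:E * P A <= 'E_P[f])%E.
Proof.
move=> mD PD mf f0 mA AD c0 fc; rewrite (expectation_restrict mD PD mf).
have mEf B : measurable_fun B (EFin \o f).
  by apply: measurable_funTS; apply/measurable_EFinP.
apply: (@le_trans _ _ (\int[P]_(x in A) (f x)%:E)%E); last first.
  by apply: ge0_subset_integral => // x /f0; rewrite lee_fin.
by rewrite -(integral_cst P mA); apply: ge0_le_integral.
Qed.

Lemma expectation_le d (T : measurableType d) (R : realType)
    (P : probability T R) (D A : set T) (f : T -> R) (c : R) :
  measurable D -> P D = 1%E -> measurable_fun setT f ->
  (forall x, D x -> 0 <= f x <= 1) ->
  measurable A -> A `<=` D -> 0 <= c ->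
  (forall x, (D `\` A) x -> f x <= c) ->
  ('E_P[f] <= P A + c%:E)%E.
Proof.
move=> mD PD mf f01 mA AD c0 fc; rewrite (expectation_restrict mD PD mf).
have mEf B : measurable_fun B (EFin \o f).
  by apply: measurable_funTS; apply/measurable_EFinP.
have mDA : measurable (D `\` A) by exact: measurableD.
rewrite -{1}(setDUK AD) ge0_integral_setU//; last 2 first.
- by move=> x; rewrite setDUK// => /f01 /andP[fx _]; rewrite lee_fin.
- by rewrite disj_set2E setDIK.
apply: leeD.
  rewrite -[leRHS]mul1e -(integral_cst P mA).
  by apply: ge0_le_integral => // x /AD /f01 /andP[? ?]; rewrite lee_fin.
apply: (@le_trans _ _ (c%:E * P (D `\` A))%E).
  rewrite -(integral_cst P mDA); apply: ge0_le_integral => // x.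
  by move=> [/f01 /andP[? _] _]; rewrite lee_fin.
by rewrite -[leRHS]mule1 lee_wpmul2l ?lee_fin// probability_le1.
Qed.

(** * Choice of the parameters *)

(** Since [9 / 25 <= 1 / 2 <= exp (- 1 / 2)], an exponent at least
[2 ln (4 / eps)] suffices, and [4 / eps <= (1 / eps) ^ 3] because
[eps < 1 / 2].  Rounding costs at most 1, which is at most [2 ln (1 / eps)]. *)
Lemma exists_rounds (R : realType) (eps : R) : 0 < eps -> eps < 1 / 2 ->
  exists2 s : nat, (9 / 25) ^+ s.+1 <= eps / 4 & s.+1%:R <= 8 * ln (1 / eps).
Proof.
move=> e0 e12; set L := ln (1 / eps).
have LE : L = - ln eps by rewrite /L div1r lnV.
have ln2 : ln (2^-1) <= - 2^-1 :> R.
  have := @le_ln1Dx R (- 2^-1); rewrite (_ : 1 + - 2^-1 = 2^-1); last by field.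
  by apply; lra.
have lnle : ln eps <= ln (2^-1) by rewrite ler_ln ?posrE ?invr_gt0//; lra.
have ln4 : ln (eps / 4) = ln eps + 2 * ln (2^-1).
  rewrite (_ : eps / 4 = eps * (2^-1) ^+ 2); last by field.
  by rewrite lnM ?posrE ?exprn_gt0 ?invr_gt0// lnXn ?invr_gt0// mulr_natl.
exists (Num.truncn (6 * L)); last first.
  have := truncn_le (6 * L); rewrite -natr1 mulr_ge0 ?LE; lra.
have tg := truncnS_gt (6 * L); set r := (Num.truncn (6 * L)).+1 in tg *.
apply: (@le_trans _ _ (expR (- 2^-1) ^+ r)).
  apply: lerXn2r; rewrite ?nnegrE ?expR_ge0//.
  by apply: le_trans (expR_ge1Dx _); lra.
rewrite -expRM_natl -ler_ln ?posrE ?expR_gt0// ?divr_gt0// expRK ln4; nra.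
Qed.

(** The affine map sends the midpoint of [[a, b]] to 0 and is scaled by
[2 h], an upper bound for the distance from the midpoint to any point of
[[- h, h]]. *)
Lemma step_poly_itv (R : realType) (h a b : R) (m s : nat) :
  - h <= a -> a < b -> b <= h -> 8 * h <= m.*2.+1%:R * (b - a) ->
  exists p : {poly R},
    [/\ (degree p <= (4 * m * s.+1).+1)%N,
        forall x, - h <= x <= h -> 0 <= p.[x] <= 1,
        forall x, b <= x <= h -> p.[x] <= (9 / 25) ^+ s.+1
      & forall x, - h <= x <= a -> 1 - (9 / 25) ^+ s.+1 <= p.[x]].
Proof.
move=> ha ab bh mab; have h0 : 0 < h by lra.
have h40 : 0 < 4 * h by lra.
have d0 : 0 < (b - a) / (4 * h) by rewrite divr_gt0//; lra.
have d1 : (b - a) / (4 * h) <= 1 by rewrite ler_pdivrMr//; lra.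
have nd : 2 <= m.*2.+1%:R * ((b - a) / (4 * h)).
  by rewrite mulrA ler_pdivlMr//; move: mab; lra.
have [q [sq q01 qR qL]] := step_poly s d0 d1 nd.
pose g : {poly R} := (2 * h)^-1 *: ('X - ((a + b) / 2)%:P).
have gE x : (q \Po g).[x] = q.[(x - (a + b) / 2) / (2 * h)].
  by rewrite horner_comp hornerZ hornerXsubC mulrC.
have h20 : 0 < 2 * h by lra.
have dE : (b - a) / (4 * h) = (b - a) / 2 / (2 * h).
  by field; lra.
have dEN : - ((b - a) / (4 * h)) = (a - b) / 2 / (2 * h) by field; lra.
exists (q \Po g); split=> [|x /andP[x1 x2]|x /andP[x1 x2]|x /andP[x1 x2]];
  rewrite ?gE.
- have predn_le (i k : nat) : (i <= k.+1 -> i.-1 <= k)%N by case: i.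
  have sg : (size g <= 2)%N.
    by rewrite (leq_trans (size_scale_leq _ _))// size_XsubC.
  apply/predn_le/(leq_trans (size_comp_poly_leq _ _)); rewrite ltnS.
  by rewrite -[leqRHS]muln1 leq_mul// predn_le.
- by apply: q01; rewrite ler_pdivlMr// ler_pdivrMr//; apply/andP; split; lra.
- apply: qR; rewrite dE ler_pM2r ?invr_gt0// [X in _ && X]ler_pdivrMr//.
  by apply/andP; split; lra.
- apply: qL; rewrite dEN ler_pM2r ?invr_gt0// [X in X && _]ler_pdivlMr//.
  by apply/andP; split; lra.
Qed.

Theorem proposition2 (R : realType) (h : R) (hpos : 0 < h) :
  exists2 C : R, 0 < C &
    forall (pi pihat : probability (measurableTypeR R) R) (a b eps : R),
      supported_on pi `[- h, h] -> supported_on pihat `[- h, h] ->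
      a \in `[- h, h] -> b \in `[- h, h] -> a < b -> eps \in `]0, 1 / 2[ ->
      (pihat `[(- h)%R, a]%classic > pi `[(- h)%R, b]%classic + eps%:E)%E ->
      exists p : {poly R},
        [/\ (degree p)%:R <= C * (1 / (b - a) * ln (1 / eps)),
            forall x : R, x \in `[- h, h] -> 0 <= p.[x] <= 1
          & (`| 'E_pihat[fun theta => p.[theta]%R]
                - 'E_pi[fun theta => p.[theta]%R] | >= (eps / 2)%:E)%E].
Proof.
exists (208 * h) => [|pi pihat a b eps spi spihat]; first by rewrite mulr_gt0.
rewrite !in_itv/= => /andP[ha ah] /andP[hb bh] ab /andP[e0 e12] gap.
have [s serr sL] := exists_rounds e0 e12.
set L := ln (1 / eps) in sL *.
have ba0 : 0 < b - a by lra.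
pose u := 4 * h / (b - a).
have u2 : 2 <= u by rewrite /u ler_pdivlMr//; lra.
(* [2 m + 1 >= 2 u] is the condition on [m]; [u >= 2] absorbs the rounding. *)
have tg := truncnS_gt u.
have tl : (Num.truncn u)%:R <= u by rewrite truncn_le; lra.
set m := (Num.truncn u).+1 in tg.
have mu : m%:R <= 3 / 2 * u by rewrite /m -natr1; lra.
have mab : 8 * h <= m.*2.+1%:R * (b - a).
  have : 4 * h < m%:R * (b - a) by rewrite -ltr_pdivrMr.
  rewrite (_ : m.*2.+1%:R = 2 * m%:R + 1); first by nra.
  by rewrite -muln2; ring.
have [p [dp p01 pR pL]] := step_poly_itv s ha ab bh mab.
exists p; split=> [|x|].
(* With [r = s + 1], [4 m r + 1 <= 48 u L + 1]; as [r >= 1], [L >= 1 / 8],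
so the last 1 is at most [4 u L]. *)
- have s0 : 1 <= s.+1%:R :> R by rewrite ler1n.
  have : (degree p)%:R <= 4 * m%:R * s.+1%:R + 1 :> R.
    by rewrite -!natrM natr1 ler_nat.
  have m0 : 0 <= m%:R :> R by [].
  have H : m%:R * s.+1%:R <= (3 / 2 * u) * (8 * L) by rewrite ler_pM.
  rewrite (_ : 208 * h * _ = 52 * (u * L)); last by rewrite /u; field; lra.
  by have : 1 / 4 <= u * L; nra.
- by rewrite in_itv/=; exact: p01.
- have sub c : c <= h -> `[- h, c] `<=` `[- h, h].
    by move=> ch x/=; rewrite !in_itv/= => /andP[-> /le_trans->].
  have mp : measurable_fun [set: measurableTypeR R] (horner p).
    exact: measurable_poly.
  have Ehat : ((1 - eps / 4)%:E * pihat `[(- h)%R, a]%classic <=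
      'E_pihat[fun theta => p.[theta]%R])%E.
    apply: (expectation_ge _ spihat mp) => //.
    + by move=> x/=; rewrite in_itv/= => /p01 /andP[].
    + exact: sub.
    + lra.
    + move=> x/=; rewrite in_itv/= => /pL; apply: le_trans; lra.
  have Epi : ('E_pi[fun theta => p.[theta]%R] <=
      pi `[(- h)%R, b]%classic + (eps / 4)%:E)%E.
    apply: (expectation_le _ spi mp) => //.
    + exact: sub.
    + lra.
    + move=> x/= []; rewrite !in_itv/= => /andP[x1 x2] /negP.
      rewrite x1/= -ltNge.
      by move=> /ltW bx; apply: le_trans serr; rewrite pR// bx.
  apply: le_trans (lee_abs _).
  apply: le_trans (leeB Ehat Epi).
  have pihat1 : (pihat `[(- h)%R, a]%classic <= 1)%E by exact: probability_le1.
  move: gap pihat1.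
  rewrite -(fineK (fin_num_measure pihat _ (measurable_itv `[- h, a]))).
  rewrite -(fineK (fin_num_measure pi _ (measurable_itv `[- h, b]))).
  move: (fine _) (fine _) => U V; rewrite -EFinM -!EFinD lte_fin !lee_fin.
  by nra.
Qed.
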